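(* Let $s \in (0,1]$ and let $E \subseteq \mathbb{R}^2$ be a union of subsets of lines each of which has Hausdorff dimension at least $s$. Then $$\dim_{\mathrm H} L_s^{\mathrm H}(E) \leq \dim_{\mathrm H} E + 2 - 2s.$$ In particular, if $E \subseteq \mathbb{R}^2$ is a union of line segments and $\mathbf{L}(E)$ is its lineal extension, then $\dim_{\mathrm H} \mathbf{L}(E) = \dim_{\mathrm H} E$.
   Context: $\dim_{\mathrm H}$ denotes Hausdorff dimension. Sets are arbitrary (no measurability is assumed). $\mathcal{A}(n,1)$ is the set of all (affine) lines in $\mathbb{R}^n$. Line segments are nondegenerate. For $s \in (0,1]$ and $E \subseteq \mathbb{R}^n$ a union of subsets of lines with Hausdorff dimension at least $s$, the $s$-Hausdorff extension of $E$ is $$L_s^{\mathrm H}(E) := \bigcup \{ \ell \in \mathcal{A}(n,1) : \dim_{\mathrm H}(\ell \cap E) \geq s \}.$$ If $E \subseteq \mathbb{R}^n$ is a union of line segments, its lineal extension is $$\mathbf{L}(E) := \bigcup \{ \ell \in \mathcal{A}(n,1) : E \cap \ell \text{ contains a line segment} \}.$$ *)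

(* Defs.v *)
From HB Require Import structures.
From mathcomp Require Import all_boot all_order all_algebra.
From mathcomp Require Import all_classical all_reals all_analysis.

Set Implicit Arguments.
Unset Strict Implicit.
Unset Printing Implicit Defensive.

Import Order.TTheory GRing.Theory Num.Theory.
Import numFieldNormedType.Exports.

Local Open Scope classical_set_scope.
Local Open Scope ring_scope.

Section Hausdorff.
Context {R : realType} {n : nat}.
Implicit Types (x y : 'rV[R]_n) (A : set 'rV[R]_n) (r delta : R).

(* The library norm on 'rV[R]_n is the sup norm, hence an explicit Euclidean
   distance. *)
Definition edist x y : R := Num.sqrt (\sum_(i < n) (x 0 i - y 0 i) ^+ 2).

(* diam set0 = -oo *)
Definition diam A : \bar R :=
  ereal_sup [set (edist x y)%:E | x in A & y in A].

(* The case A = set0 matters only for r = 0, where poweR would give 1;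
   for nonempty A, 0 `^ 0 = 1 is the usual convention. *)
Definition diam_pow r A : \bar R :=
  if A == set0 then 0%E else poweR (diam A) r.

Definition delta_cover delta A : set (nat -> set 'rV[R]_n) :=
  [set F | A `<=` \bigcup_k F k /\ forall k, (diam (F k) <= delta%:E)%E].

Definition hausdorff_content r delta A : \bar R :=
  ereal_inf [set (\sum_(0 <= k <oo) diam_pow r (F k))%E
            | F in delta_cover delta A].

Definition hausdorff_measure r A : \bar R :=
  ereal_sup [set hausdorff_content r delta A
            | delta in [set delta | 0 < delta]].

Definition hausdorff_dim A : \bar R :=
  ereal_inf [set r%:E | r in [set r | 0 <= r /\ hausdorff_measure r A = 0%E]].

End Hausdorff.

Section Extensions.
Context {R : realType} {n : nat}.
Implicit Types (x v : 'rV[R]_n) (E S l : set 'rV[R]_n) (s : R).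

Definition affine_line x v : set 'rV[R]_n := [set x + t *: v | t in [set: R]].

Definition affine_lines : set (set 'rV[R]_n) :=
  [set l | exists x v, v != 0 /\ l = affine_line x v].

(* Closed segments suffice: every open or half-open nondegenerate segment is a
   union of closed nondegenerate ones, and contains one. *)
Definition line_segments : set (set 'rV[R]_n) :=
  [set S | exists x y : 'rV[R]_n,
     x != y /\ S = [set (1 - t) *: x + t *: y | t in `[0, 1]]].

Definition union_of_line_subsets s E : Prop :=
  exists2 C : set (set 'rV[R]_n),
    (forall S, C S ->
       (exists2 l, affine_lines l & S `<=` l) /\ (s%:E <= hausdorff_dim S)%E)
    & E = \bigcup_(S in C) S.

Definition hausdorff_extension s E : set 'rV[R]_n :=
  \bigcup_(l in [set l | affine_lines l /\
                         (s%:E <= hausdorff_dim (l `&` E))%E]) l.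

Definition union_of_segments E : Prop :=
  exists2 C : set (set 'rV[R]_n), C `<=` line_segments & E = \bigcup_(S in C) S.

Definition lineal_extension E : set 'rV[R]_n :=
  \bigcup_(l in [set l | affine_lines l /\
                         exists2 S, line_segments S & S `<=` E `&` l]) l.

End Extensions.

(* Main.v *)
(* Fix a cover of [E] by dyadic squares of sides [2^-t] that is cheap in
   dimension [d > dim E]. A line [l] with [dim (l & E) >= s] must, at some scale
   [t], hit almost [M = 2^(ts)] of the at most [2^(td)] chosen squares. Among
   lines of slope at most 1 pick, on a vertical slice, lines through [N] distinct
   cells of height [2^-t]: two of them at distance [h 2^-t] on the slice have at
   most about [2^t / h] squares in common, so Cordoba's L^2 argument gives
   [(M N)^2 <= 2^(td) N 2^t] up to logarithms, i.e. [N <= 2^(t(d + 1 - 2s))].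
   Summing over the [2^t] slices covers the extension by about
   [2^(t(d + 2 - 2s))] cells of side [2^-t]. *)
Require Import Defs.
From HB Require Import structures.
From mathcomp Require Import all_boot all_order all_algebra.
From mathcomp Require Import all_classical all_reals all_analysis.
From mathcomp Require Import ring lra zify.

Set Implicit Arguments.
Unset Strict Implicit.
Unset Printing Implicit Defensive.

Import Order.TTheory GRing.Theory Num.Theory.
Import numFieldNormedType.Exports.

Local Open Scope classical_set_scope.
Local Open Scope ring_scope.

(* [edist] is also the extended distance of MathComp-Analysis. *)
Local Notation edist := Defs.edist.

(** * Hausdorff content *)

Section Content.
Context {R : realType} {n : nat}.
Implicit Types (A B : set 'rV[R]_n) (r delta : R).

(** The sets are arbitrary, so the size of the part of [E] on a line is measured by Hausdorff
    content: a lower bound on the content tests directly against every cover by small sets. The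
    obstacle is uniformity. The rich scale depends on the line, and neither the position of a line
    nor the content it carries is bounded a priori. Hence the extension is exhausted by countably
    many strata indexed by [c], on which intercept, window, content and cover scale are controlled
    by powers of 2; each stratum is cut again by scale and the bounds are summed over [t]. Every
    soft loss (rounding a cover to dyadic scales, the logarithm, pigeonholing over scales, summing
    over scales) is a factor 2^(kt) up to a constant, and [k] is arbitrarily small. *)

Lemma diam_pow_ge0 r A : (0 <= diam_pow r A)%E.
Proof. by rewrite /diam_pow; case: ifP => // _; exact: poweR_ge0. Qed.

Lemma hausdorff_content_ge0 r delta A : (0 <= hausdorff_content r delta A)%E.
Proof.
apply: le_ereal_inf_tmp => _ [F _ <-].
by apply: nneseries_ge0 => k _ _; exact: diam_pow_ge0.
Qed.

Lemma diam_le A (rho : R) :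
  (forall x y, A x -> A y -> edist x y <= rho) -> (diam A <= rho%:E)%E.
Proof.
by move=> h; apply: ge_ereal_sup => _ [x Ax [y Ay <-]]; rewrite lee_fin h.
Qed.

Lemma edist_le_diam A x y : A x -> A y -> ((edist x y)%:E <= diam A)%E.
Proof. by move=> Ax Ay; apply: ereal_sup_ubound; exists x => //; exists y. Qed.

Lemma edist_ge0 (x y : 'rV[R]_n) : 0 <= edist x y.
Proof. exact: sqrtr_ge0. Qed.

Lemma diam_ge0 A : A !=set0 -> (0 <= diam A)%E.
Proof.
move=> [x Ax]; apply: le_trans _ (edist_le_diam Ax Ax).
by rewrite lee_fin edist_ge0.
Qed.

Lemma diam_pow_nonempty r A : A !=set0 -> diam_pow r A = poweR (diam A) r.
Proof. by move=> /set0P/negbTE h; rewrite /diam_pow h. Qed.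

Lemma hausdorff_content_mono r delta delta' A B :
  A `<=` B -> delta' <= delta ->
  (hausdorff_content r delta A <= hausdorff_content r delta' B)%E.
Proof.
move=> AB dd; apply: ereal_inf_le_tmp => _ [F [BF Fd] <-]; exists F => //.
split; first exact: subset_trans BF.
by move=> k; apply: le_trans (Fd k) _; rewrite lee_fin.
Qed.

Lemma hausdorff_content_set0 r delta : hausdorff_content r delta (set0 : set 'rV[R]_n) = 0%E.
Proof.
apply/eqP; rewrite eq_le hausdorff_content_ge0 andbT.
apply: ereal_inf_lbound; exists (fun=> set0); first split => //.
  move=> k; rewrite /diam (_ : [set _ | _ in _ & _ in _] = set0) ?ereal_sup0 ?leNye//.
  by apply/seteqP; split => // ? [].
by apply: eseries0 => k _ _; rewrite /diam_pow eqxx.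
Qed.

Lemma hausdorff_content_bigcup r delta (A : nat -> set 'rV[R]_n) :
  (hausdorff_content r delta (\bigcup_k A k)
     <= \sum_(0 <= k <oo) hausdorff_content r delta (A k))%E.
Proof.
(* A near-optimal cover can be chosen only where the content is finite; one infinite content makes
   the right-hand side infinite. *)
have [[i ioo]|noo] := pselect (exists i, hausdorff_content r delta (A i) = +oo%E).
  rewrite (nneseries_pinfty _ _ ioo) ?leey// => k _.
  exact: hausdorff_content_ge0.
apply/lee_addgt0Pr => e e0.
apply: le_trans (epsilon_trick _ _ (ltW e0)); last first.
  by move=> k; exact: hausdorff_content_ge0.
have /choice[G PG] : forall k, exists F : nat -> set 'rV[R]_n,
    delta_cover delta (A k) F /\ (\sum_(0 <= l <oo) diam_pow r (F l) <=
      hausdorff_content r delta (A k) + (e / (2 ^ k.+1)%:R)%:E)%E.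
  move=> k; have /ereal_inf_lt[_ [F HF <-] lF] : (hausdorff_content r delta (A k) <
      hausdorff_content r delta (A k) + (e / (2 ^ k.+1)%:R)%:E)%E.
    rewrite lteDl ?lte_fin ?divr_gt0 ?ltr0n ?expn_gt0//.
    rewrite ge0_fin_numE ?hausdorff_content_ge0// ltey.
    by apply/eqP => oo; apply: noo; exists k.
  by exists F; split=> //; exact: ltW.
have g0 i : (0 <= diam_pow r (uncurry G i))%E by exact: diam_pow_ge0.
apply: (@le_trans _ _ (\esum_(i in setT) diam_pow r (uncurry G i))).
  have /card_esym/ppcard_eqP[f] := card_nat2.
  apply: ereal_inf_lbound; exists (uncurry G \o f).
    split=> [x [k _ /(PG k).1.1[l _ Gx]]|k]; last first.
      by rewrite /= /uncurry; case: (f k) => a b; exact: (PG a).1.2.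
    by exists (f^-1%FUN (k, l)) => //=; rewrite invK ?inE.
  rewrite nneseries_esumT; last by move=> k; exact: diam_pow_ge0.
  by rewrite [RHS](reindex_esum setT setT f).
have -> : \esum_(i in setT) diam_pow r (uncurry G i) =
    \esum_(k in [set: nat]) \esum_(l in [set: nat]) diam_pow r (G k l).
  rewrite esum_esum; last by move=> *; exact: diam_pow_ge0.
  rewrite (_ : setT `*`` (fun=> setT) = [set: nat * nat]); last by apply/seteqP.
  by apply: eq_esum => -[].
rewrite -nneseries_esumT; last first.
  by move=> k; apply: esum_ge0 => *; exact: diam_pow_ge0.
apply: lee_nneseries => k _.
  by move=> _; apply: esum_ge0 => *; exact: diam_pow_ge0.
rewrite -nneseries_esumT; last by move=> *; exact: diam_pow_ge0.
exact: (PG k).2.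
Qed.

Lemma hausdorff_content_bigcup_seq (I : eqType) (s : seq I) (P : pred I) r delta
    (A : I -> set 'rV[R]_n) :
  (hausdorff_content r delta (\bigcup_(i in [set i | (i \in s) && P i]) A i)
     <= \sum_(i <- s | P i) hausdorff_content r delta (A i))%E.
Proof.
rewrite -big_filter; set s' := [seq i <- s | P i].
have -> : [set i | (i \in s) && P i] = [set` s'].
  by apply/seteqP; split=> i /=; rewrite mem_filter andbC.
case: s' => [|x0 s'].
  rewrite big_nil (_ : \bigcup_(_ in _) _ = set0) ?hausdorff_content_set0//.
  by apply/seteqP; split => // ? [].
pose B k := if (k < size (x0 :: s'))%N then A (nth x0 (x0 :: s') k) else set0.
apply: (@le_trans _ _ (hausdorff_content r delta (\bigcup_k B k))).
  apply: hausdorff_content_mono => // x [i /= si Ai].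
  exists (index i (x0 :: s')) => //.
  by rewrite /B index_mem si nth_index.
apply: (le_trans (hausdorff_content_bigcup _ _ _)).
rewrite (nneseries_split 0 (size (x0 :: s'))); last first.
  by move=> *; exact: hausdorff_content_ge0.
rewrite add0n [X in (_ + X)%E]eseries0 ?adde0; last first.
  by move=> k sk _; rewrite /B ltnNge sk /= hausdorff_content_set0.
rewrite [leRHS](big_nth x0) [leLHS]big_nat [leRHS]big_nat.
by apply: lee_sum => k /andP[_ ks]; rewrite /B ks.
Qed.

Lemma hausdorff_content_le_pow r delta A (rho : R) : 0 <= r -> rho <= delta ->
  (forall x y, A x -> A y -> edist x y <= rho) ->
  (hausdorff_content r delta A <= (rho `^ r)%:E)%E.
Proof.
move=> r0 rd Ar.
have [->|/set0P A0] := eqVneq A set0.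
  by rewrite hausdorff_content_set0 lee_fin powR_ge0.
(* Padding with [set0] is free even for [r = 0], because [diam_pow] gives the empty set weight 0. *)
pose F (k : nat) : set 'rV[R]_n := if k == 0%N then A else set0.
have dF k : (diam (F k) <= delta%:E)%E.
  case: k => [|k] /=; apply: diam_le => // x y Ax Ay.
  exact: le_trans (Ar _ _ Ax Ay) rd.
have dA := diam_le Ar.
apply: (@le_trans _ _ (\sum_(0 <= k <oo) diam_pow r (F k))%E).
  apply: ereal_inf_lbound; exists F => //; split => // x Ax; by exists 0%N.
rewrite (nneseries_split 0 1) ?add0n; last by move=> *; exact: diam_pow_ge0.
rewrite big_nat1 eseries0 ?adde0; last first.
  by case=> [|k] //= _ _; rewrite /diam_pow eqxx.
rewrite diam_pow_nonempty// -poweR_EFin gt0_ler_poweR//.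
  by rewrite in_itv /= diam_ge0 //= leey.
by rewrite in_itv /= leey andbT (le_trans (diam_ge0 A0)).
Qed.

Lemma hausdorff_measure_eq0 r A :
  hausdorff_measure r A = 0%E <->
  forall delta, 0 < delta -> hausdorff_content r delta A = 0%E.
Proof.
split=> [h delta d0|h].
  apply/eqP; rewrite eq_le hausdorff_content_ge0 andbT -h.
  by apply: ereal_sup_ubound; exists delta.
apply/eqP; rewrite eq_le; apply/andP; split.
  by apply: ge_ereal_sup => _ [d d0 <-]; rewrite h.
apply: le_trans (hausdorff_content_ge0 r 1 A) _.
by apply: ereal_sup_ubound; exists 1 => //=.
Qed.

Lemma hausdorff_measure_bigcup_eq0 r (A : nat -> set 'rV[R]_n) :
  (forall k, hausdorff_measure r (A k) = 0%E) ->
  hausdorff_measure r (\bigcup_k A k) = 0%E.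
Proof.
move=> h; apply/hausdorff_measure_eq0 => delta d0.
apply/eqP; rewrite eq_le hausdorff_content_ge0 andbT.
apply: le_trans (hausdorff_content_bigcup _ _ _) _.
by rewrite eseries0// => k _ _; apply: (hausdorff_measure_eq0 _ _).1.
Qed.

Lemma hausdorff_measure_sub_eq0 r A B : A `<=` B ->
  hausdorff_measure r B = 0%E -> hausdorff_measure r A = 0%E.
Proof.
move=> AB /hausdorff_measure_eq0 h; apply/hausdorff_measure_eq0 => delta d0.
apply/eqP; rewrite eq_le hausdorff_content_ge0 andbT -(h _ d0).
exact: hausdorff_content_mono.
Qed.

Lemma hausdorff_dim_mono A B : A `<=` B -> (hausdorff_dim A <= hausdorff_dim B)%E.
Proof.
move=> AB; apply: ereal_inf_le_tmp => _ [r [r0 h] <-].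
by exists r => //; split=> //; exact: hausdorff_measure_sub_eq0 h.
Qed.

Lemma hausdorff_dim_le r A : 0 <= r -> hausdorff_measure r A = 0%E ->
  (hausdorff_dim A <= r%:E)%E.
Proof. by move=> r0 h; apply: ereal_inf_lbound; exists r. Qed.

End Content.

(** * Lines through few squares *)

Section SliceCount.
Context {R : realType}.

Lemma size_uniq_int_le (s : seq int) (u v : R) : uniq s -> u <= v ->
  (forall p, p \in s -> u <= p%:~R <= v) -> (size s)%:R <= v - u + 1.
Proof.
move=> us uv suv.
have [->|s0] := eqVneq s [::]; first by rewrite /=; lra.
pose a := Num.ceil u; pose m := Num.floor v.
have sam p : p \in s -> a <= p <= m.
  by move=> /suv /andP[up pv]; rewrite ceil_le_int up floor_ge_int pv.
have am : a <= m.
  case: s s0 sam {us suv} => // p s _ /(_ p (mem_head _ _)) /andP[].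
  exact: le_trans.
have sub : {subset s <= [seq a + k%:Z | k <- iota 0 `|m - a|.+1]}.
  move=> p /sam /andP[ap pm]; apply/mapP; exists `|p - a|%N; last by lia.
  by rewrite mem_iota; lia.
have := uniq_leq_size us sub; rewrite size_map size_iota => le.
have : (size s)%:R <= (`|m - a|.+1)%:R :> R by rewrite ler_nat.
move=> /le_trans; apply.
rewrite -natr1 lerD2r natr_absz ger0_norm ?subr_ge0// intrB.
by rewrite lerB// ?floor_le ?ceil_ge.
Qed.

Lemma sum_sqr_le (I : Type) (s : seq I) (m : I -> R) :
  (\sum_(i <- s) m i) ^+ 2 <= (size s)%:R * \sum_(i <- s) m i ^+ 2.
Proof.
elim: s => [|i s IH]; first by rewrite !big_nil mulr0 expr0n.
rewrite !big_cons /= -natr1.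
set S := \sum_(j <- s) m j in IH *; set T := \sum_(j <- s) _ in IH *.
set N := (size s)%:R in IH *.
(* [2 m_i S <= N m_i^2 + T], by summing [0 <= (m_i - m_j)^2] over j *)
have : 2 * m i * S <= N * m i ^+ 2 + T.
  have : 0 <= \sum_(j <- s) (m i - m j) ^+ 2.
    by apply: sumr_ge0 => j _; exact: sqr_ge0.
  have -> : \sum_(j <- s) (m i - m j) ^+ 2 = N * m i ^+ 2 - 2 * m i * S + T.
    rewrite /N /S /T; elim: (s) => [|j t IHt] /=; first by rewrite !big_nil; ring.
    by rewrite !big_cons IHt -natr1; ring.
  lra.
lra.
Qed.

Definition harmonic_sum (W : nat) : R := \sum_(0 <= k < W) k.+1%:R^-1.

(** The block of indices from 2^m to 2^(m+1) has 2^m terms, each at most 2^-m, so doubling the range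
    adds at most 1. This is the logarithm lost in Cordoba's argument. *)
Lemma harmonic_sum_pow2 m : harmonic_sum (2 ^ m) <= m.+1%:R.
Proof.
elim: m => [|m IH]; first by rewrite /harmonic_sum big_nat1 invr1.
rewrite /harmonic_sum (@big_cat_nat _ _ _ (2 ^ m)) ?leq_exp2l//=.
rewrite -[leRHS]natr1 lerD//.
apply: (@le_trans _ _ (\sum_(2 ^ m <= k < 2 ^ m.+1) ((2 ^ m)%:R^-1 : R))).
  rewrite big_nat [leRHS]big_nat; apply: ler_sum => k /andP[mk _].
  by rewrite lef_pV2 ?posrE ?ltr0n ?expn_gt0// ler_nat (leq_trans mk).
rewrite sumr_const_nat expnS mul2n -addnn addnK -[leLHS]mulr_natr mulVf.
  by [].
by rewrite pnatr_eq0 expn_eq0.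
Qed.

Lemma harmonic_sum_mono : {homo harmonic_sum : V W / (V <= W)%N >-> V <= W}.
Proof.
move=> V W VW; rewrite /harmonic_sum (@big_cat_nat _ _ _ V 0 W)//= lerDl.
by apply: sumr_ge0.
Qed.

(** On either side of [r] the distances are distinct, so each side is dominated by one harmonic sum.
    This bounds the overlaps of one line with all the others of a slice. *)
Lemma sum_inv_dist_le (W r : nat) : (r < W)%N ->
  \sum_(0 <= k < W) (`|r%:Z - k%:Z|.+1)%:R^-1 <= 2 * harmonic_sum W.
Proof.
move=> rW; rewrite (@big_cat_nat _ _ _ r) ?(ltnW rW)//= mulr_natl mulr2n.
apply: lerD.
  rewrite big_nat_rev /= add0n.
  apply: (@le_trans _ _ (harmonic_sum r)); last exact/harmonic_sum_mono/ltnW.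
  rewrite /harmonic_sum big_nat [leRHS]big_nat; apply: ler_sum => k kr.
  by rewrite lef_pV2 ?posrE ?ltr0n// ler_nat; lia.
rewrite -{1}[r]add0n big_addn.
apply: (@le_trans _ _ (harmonic_sum (W - r))); last exact/harmonic_sum_mono/leq_subr.
by apply: ler_sum => k _; rewrite lef_pV2 ?posrE ?ltr0n// ler_nat; lia.
Qed.

Lemma mem_pm1 (e : int) : -2 < e -> e < 2 -> e \in [:: -1; 0; 1].
Proof.
move=> e1 e2; have [->|[->|->]] : e = -1 \/ e = 0 \/ e = 1 by lia.
all: by rewrite !inE.
Qed.

Lemma floor_near (x y : R) : `|x - y| <= 1 ->
  Num.floor y - Num.floor x \in [:: -1; 0; 1].
Proof.
rewrite ler_norml => /andP[d1 d2].
have /andP[q1 q2] := floor_itv x; rewrite intrD in q2.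
have /andP[r1 r2] := floor_itv y; rewrite intrD in r2.
have : (Num.floor y - Num.floor x)%:~R < 2%:~R :> R by rewrite intrB; lra.
have : (-2)%:~R < (Num.floor y - Num.floor x)%:~R :> R by rewrite intrB; lra.
by rewrite !ltr_int => ? ?; exact: mem_pm1.
Qed.

(* [Q] stands for the half-open unit square with lower left corner [Q]. *)
Definition hits (B : nat) (l : R * R) (Q : int * int) : bool :=
  `[< exists x, [/\ `|x| <= B%:R, Num.floor x = Q.1 & Num.floor (l.1 * x + l.2) = Q.2] >].

(** A line of slope at most 1 varies by at most 1 over a column of unit width, so it meets at most
    three squares of the column. Counting squares thus reduces to counting columns. *)
Lemma hits_column B l Q : `|l.1| <= 1 -> hits B l Q ->
  [/\ `|Q.1%:~R| <= B%:R + 1 :> R,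
      `|l.1 * Q.1%:~R + l.2 - Q.2%:~R| <= 2 &
      (Q.2 - Num.floor (l.1 * Q.1%:~R + l.2)) \in [:: -1; 0; 1 : int]].
Proof.
move=> l1 /asboolP[x [xB <- <-]].
have /andP[p1 p2] := floor_itv x; rewrite intrD in p2.
set p := Num.floor x in p1 p2 *.
have dx : `|l.1 * p%:~R + l.2 - (l.1 * x + l.2)| <= 1.
  have -> : l.1 * p%:~R + l.2 - (l.1 * x + l.2) = l.1 * (p%:~R - x) by ring.
  rewrite normrM -[leRHS]mulr1 ler_pM// ler_norml; apply/andP; split; lra.
set y := l.1 * x + l.2 in dx *; set z := l.1 * p%:~R + l.2 in dx *.
have /andP[q1 q2] := floor_itv y; rewrite intrD in q2.
have near := floor_near dx.
move: dx xB; rewrite !ler_norml => /andP[d1 d2] /andP[x1 x2].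
by split=> //; apply/andP; split; lra.
Qed.

(* If the lines share a square at all, then their slopes differ by at least about
   [h / B], so they stay close together in only [O(B / h)] columns. *)
Lemma count_hits2 (B : nat) (l l' : R * R) (x0 : R) (h : nat) (P : seq (int * int)) :
  (0 < B)%N -> uniq P -> `|l.1| <= 1 -> `|l'.1| <= 1 -> `|x0| <= B%:R + 1 ->
  (h <= 8 * B)%N -> h%:R - 1 <= `|(l.1 * x0 + l.2) - (l'.1 * x0 + l'.2)| ->
  (count (fun Q => hits B l Q && hits B l' Q) P)%:R * h.+1%:R <= 336 * B%:R :> R.
Proof.
move=> B0 uP l1 l1' x0B hB hx0.
pose s := [seq Q <- P | hits B l Q && hits B l' Q].
pose ps := undup [seq Q.1 | Q <- s].
rewrite -size_filter -/s.
have B1 : 1 <= B%:R :> R by rewrite ler1n.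
have szs : (size s <= 3 * size ps)%N.
  pose f (p : int) := Num.floor (l.1 * p%:~R + l.2).
  rewrite (_ : 3%N = size [:: -1; 0; 1 : int]) // mulnC.
  rewrite -(size_allpairs (fun p e => (p, f p + e))).
  apply: uniq_leq_size; first exact: filter_uniq.
  move=> Q sQ; have := sQ; rewrite mem_filter => /andP[/andP[hQ _] _].
  have [_ _ h3] := hits_column l1 hQ.
  apply/allpairsP; exists (Q.1, Q.2 - f Q.1); split => //=.
    by rewrite mem_undup map_f.
  by rewrite addrC subrK -surjective_pairing.
have psP p : p \in ps -> `|p%:~R| <= B%:R + 1 :> R /\
    `|(l.1 - l'.1) * p%:~R + (l.2 - l'.2)| <= 4.
  rewrite mem_undup => /mapP[Q]; rewrite mem_filter => /andP[/andP[hQ hQ'] _] ->.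
  have [a1 a2 _] := hits_column l1 hQ.
  have [_ b2 _] := hits_column l1' hQ'.
  split => //.
  move: a2 b2; rewrite !ler_norml => /andP[? ?] /andP[? ?].
  by apply/andP; split; lra.
have sz1 : (size ps)%:R <= 5 * B%:R :> R.
  apply: (@le_trans _ _ ((B%:R + 1) - (- (B%:R + 1)) + 1)); last by lra.
  apply: size_uniq_int_le; [exact: undup_uniq|lra|].
  by move=> p /psP[+ _]; rewrite ler_norml.
suff : (size ps)%:R * h.+1%:R <= 112 * B%:R :> R.
  have : (size s)%:R <= 3 * (size ps)%:R :> R by rewrite -natrM ler_nat.
  have : 0 <= h.+1%:R :> R by [].
  nra.
(* For small [h] the trivial bound of [5 * B] columns is enough. From 10 on, h - 5 >= h / 2, which
   absorbs the additive errors below. *)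
case: (ltnP h 10) => h8.
  have : h.+1%:R <= 10 :> R by rewrite ler_nat.
  have : 0 <= h.+1%:R :> R by [].
  have : 0 <= (size ps)%:R :> R by [].
  nra.
have [->|ps0] := eqVneq ps [::]; first by rewrite mul0r; lra.
set D := l.1 - l'.1 in psP; set F := l.2 - l'.2 in psP.
have h10 : 10 <= h%:R :> R by rewrite ler_nat.
(* In a common column [p] the lines are within 4 of each other, and [x0] is within 4B of [p]. So h -
   1 <= 4 + 4B|D|, which forces the slopes apart. *)
have hD : h%:R <= 8 * B%:R * `|D|.
  case: (ps) ps0 psP => // p t _ /(_ p (mem_head _ _)) [pB pD].
  have dp : `|D * (x0 - p%:~R)| <= `|D| * (4 * B%:R).
    rewrite normrM ler_wpM2l//; apply: le_trans (ler_normB _ _) _; lra.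
  have e : (l.1 * x0 + l.2) - (l'.1 * x0 + l'.2) =
      (D * p%:~R + F) + D * (x0 - p%:~R) by rewrite /D /F; ring.
  have := ler_normD (D * p%:~R + F) (D * (x0 - p%:~R)); rewrite -e.
  lra.
have D0 : 0 < `|D|.
  rewrite lt_neqAle normr_ge0 andbT; apply/eqP => D0.
  by move: hD; rewrite -D0; lra.
(* Common columns lie within 4 / |D| of the abscissa -F / D where the two lines cross. *)
have sz2 : (size ps)%:R <= 8 / `|D| + 1.
  apply: (@le_trans _ _ ((- F / D + 4 / `|D|) - (- F / D - 4 / `|D|) + 1)); last by lra.
  apply: size_uniq_int_le; first exact: undup_uniq.
    have : 0 <= 4 / `|D| by rewrite divr_ge0.
    lra.
  move=> p /psP[_ pD]; rewrite -ler_distl.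
  have -> : p%:~R - - F / D = (D * p%:~R + F) / D.
    by field; rewrite -normr_eq0 gt_eqF.
  by rewrite normrM normfV ler_wpM2r// invr_ge0.
have hDi : h%:R / `|D| <= 8 * B%:R by rewrite ler_pdivrMr.
have hB' : h%:R <= 8 * B%:R :> R by rewrite -natrM ler_nat.
have Di : 0 <= `|D|^-1 by rewrite invr_ge0.
rewrite -natr1.
apply: (@le_trans _ _ ((8 / `|D| + 1) * (h%:R + 1))).
  by rewrite ler_wpM2r// addr_ge0.
have : 10 / `|D| <= h%:R / `|D| by rewrite ler_wpM2r.
lra.
Qed.

(* Cordoba's L^2 argument on the slice [x = x0]: [J] indexes the unit cells of
   the slice that are crossed by a line hitting many squares of [P]. *)
Lemma slice_count (B : nat) (x0 M : R) (P : seq (int * int))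
    (J : pred 'I_(8 * B)) (l : 'I_(8 * B) -> R * R) :
  (0 < B)%N -> uniq P -> `|x0| <= B%:R + 1 -> 0 <= M ->
  (forall r, J r -> [/\ `|(l r).1| <= 1,
      Num.floor ((l r).1 * x0 + (l r).2) = r%:Z - (4 * B)%:Z &
      M <= (count (hits B (l r)) P)%:R]) ->
  M ^+ 2 * #|J|%:R <= 672 * B%:R * (size P)%:R * harmonic_sum (8 * B).
Proof.
move=> B0 uP x0B M0 HJ.
have H0 : 0 <= harmonic_sum (8 * B) by apply: sumr_ge0.
have [J0|J0] := posnP #|J|.
  by rewrite J0 mulr0 mulr_ge0 ?mulr_ge0 ?ler0n.
pose m (Q : int * int) : R := \sum_(r | J r) (hits B (l r) Q)%:R.
pose S : R := \sum_(Q <- P) m Q.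
have countE (p : pred (int * int)) : (count p P)%:R = \sum_(Q <- P) (p Q)%:R :> R.
  by rewrite -sum1_count -natr_sum big_mkcond; congr (_%:R); apply: eq_bigr => Q _; case: (p Q).
have MS : M * #|J|%:R <= S.
  rewrite /S /m exchange_big /= mulr_natr -sumr_const big_mkcond /=.
  rewrite [leRHS]big_mkcond; apply: ler_sum => r _.
  rewrite unfold_in; case: ifP => // Jr.
  by have [_ _] := HJ r Jr; rewrite countE.
(* Cauchy-Schwarz over the squares turns S^2 into a sum over pairs of lines of their common squares.
   Lines through the cells [r] and [r'] are at least |r - r'| - 1 apart on the slice, so
   [count_hits2] applies with h = |r - r'|, and each row of pairs sums to 336 * 2 times B times the
   harmonic sum. *)
have SS : S ^+ 2 <= (size P)%:R * (672 * B%:R * harmonic_sum (8 * B) * #|J|%:R).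
  apply: le_trans (sum_sqr_le _ _) _; rewrite ler_wpM2l//.
  have -> : \sum_(Q <- P) m Q ^+ 2 = \sum_(r | J r) \sum_(r' | J r')
      (count (fun Q => hits B (l r) Q && hits B (l r') Q) P)%:R.
    under eq_bigr do rewrite expr2 /m mulr_suml.
    rewrite exchange_big /=; apply: eq_bigr => r _.
    under eq_bigr do rewrite mulr_sumr.
    rewrite exchange_big /=; apply: eq_bigr => r' _.
    by rewrite countE; apply: eq_bigr => Q _; rewrite -natrM mulnb.
  rewrite mulr_natr -sumr_const [leRHS](eq_bigl J)//.
  apply: ler_sum => r Jr.
  apply: (@le_trans _ _ (\sum_(r' < 8 * B) 336 * B%:R * (`|r%:Z - r'%:Z|.+1)%:R^-1)).
    rewrite big_mkcond /=; apply: ler_sum => r' _.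
    case: ifP => Jr'; last by rewrite mulr_ge0 ?mulr_ge0 ?invr_ge0 ?ler0n.
    rewrite ler_pdivlMr//.
    have [a1 a2 _] := HJ r Jr; have [b1 b2 _] := HJ r' Jr'.
    apply: (@count_hits2 _ _ _ x0) => //; first by have := ltn_ord r; have := ltn_ord r'; lia.
    have /andP[] := floor_itv ((l r).1 * x0 + (l r).2).
    have /andP[] := floor_itv ((l r').1 * x0 + (l r').2).
    rewrite a2 b2 !intrD !intrN.
    set y' := _ * x0 + _; set y := _ * x0 + _ => q1 q2 q3 q4.
    rewrite natr_absz intr_norm intrB lerBlDr ler_norml.
    have := ler_norm (y - y'); have := ler_norm (- (y - y')); rewrite normrN.
    by move=> ? ?; apply/andP; split; lra.
  rewrite -mulr_sumr (_ : 672 = 336 * 2 :> R); last by ring.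
  rewrite -!mulrA ler_wpM2l ?ler0n// mulrCA ler_wpM2l ?ler0n//.
  have := sum_inv_dist_le (ltn_ord r); rewrite big_mkord; apply.
have J1 : 0 < #|J|%:R :> R by rewrite ltr0n.
rewrite -(ler_pM2r J1).
apply: le_trans (le_trans _ SS) _; last by rewrite le_eqVlt; apply/orP; left; apply/eqP; ring.
have -> : M ^+ 2 * #|J|%:R * #|J|%:R = (M * #|J|%:R) ^+ 2 by ring.
by rewrite lerXn2r// nnegrE ?mulr_ge0// (le_trans _ MS)// mulr_ge0.
Qed.

End SliceCount.

(** * Dyadic covers of null sets *)

Section DyadicCover.
Context {R : realType}.

Lemma bernoulli (x : R) (m : nat) : 1 <= x -> 1 + m%:R * (x - 1) <= x ^+ m.
Proof.
move=> x1; elim: m => [|m IH]; first by rewrite mul0r addr0 expr0.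
rewrite exprS -natr1.
have /(ler_wpM2l (le_trans ler01 x1)) := IH.
have : 0 <= m%:R * (x - 1) ^+ 2 :> R by rewrite mulr_ge0// sqr_ge0.
lra.
Qed.

Lemma ex_expr_ge (x A : R) : 1 < x -> exists m, A <= x ^+ m.
Proof.
move=> x1; pose m := (Num.truncn (A / (x - 1))).+1; exists m.
apply: le_trans (bernoulli _ (ltW x1)).
have x10 : 0 < x - 1 by rewrite subr_gt0.
have : A / (x - 1) < m%:R by exact: truncnS_gt.
by rewrite ltr_pdivrMr// => /ltW; lra.
Qed.

Lemma powR_exprn (a r : R) (t : nat) : 0 <= a -> (a ^+ t) `^ r = (a `^ r) ^+ t.
Proof.
move=> a0; rewrite -(powR_mulrn t a0) -(powR_mulrn t (powR_ge0 a r)).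
by rewrite -powRrM -[RHS]powRrM mulrC.
Qed.

Lemma powR_half (r : R) (t : nat) : (2^-1 ^+ t) `^ r = (2 `^ r)^-1 ^+ t.
Proof.
rewrite powR_exprn ?invr_ge0//; congr (_ ^+ _).
by rewrite -[2^-1]powR_inv1// -powRrM mulN1r powRN.
Qed.

Lemma nneseries_geometric_le (a z : R) : 0 <= a -> 0 <= z < 1 ->
  (\sum_(0 <= t <oo) (a * z ^+ t)%:E <= (a / (1 - z))%:E)%E.
Proof.
move=> a0 /andP[z0 z1]; apply: lime_le.
  by apply: is_cvg_nneseries => t _ _; rewrite lee_fin mulr_ge0 ?exprn_ge0.
near=> m; rewrite sumEFin lee_fin.
have : series (geometric a z) m <= a / (1 - z); last by [].
rewrite geometric_seriesE ?lt_eqF//= -mulrA ler_wpM2l// ler_piMl//.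
  by rewrite invr_ge0 subr_ge0 ltW.
by rewrite gerBl exprn_ge0.
Unshelve. all: by end_near. Qed.

(** The scale is the [t] with 2^-(t+1) < diam F <= 2^-t, at the cost of a factor 2^(d+k). An empty
    set or a single point has no such scale and gets one fine enough to weigh less than [eta]; this
    works even for [d = 0] because [k > 0] makes the base exceed 1. *)
Lemma ex_dyadic_scale {n : nat} (F : set 'rV[R]_n) (d k eta : R) (J : nat) :
  0 <= d -> 0 < k -> 0 < eta -> (diam F <= (2^-1 ^+ J)%:E)%E ->
  exists t, [/\ (J <= t)%N,
    forall x y, F x -> F y -> edist x y <= 2^-1 ^+ t &
    (((2 `^ (d + k))^-1 ^+ t)%:E
       <= (2 `^ (d + k))%:E * diam_pow d F + eta%:E)%E].
Proof.
move=> d0 k0 eta0 FJ.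
have q1 : 1 < 2 `^ (d + k) :> R.
  rewrite -[ltLHS](powRr0 (2 : R)) /powR !gt_eqF// ltr_expR ltr_pM2r ?ln_gt0 ?ltr1n//.
  by rewrite ltr_wpDl.
have q0 : 0 < 2 `^ (d + k) :> R by exact: lt_trans q1.
have [[x [y [Fx [Fy xy]]]]|flat] :=
    pselect (exists x y, F x /\ F y /\ 0 < edist x y); last first.
  have [m mq] := ex_expr_ge eta^-1 q1.
  exists (J + m)%N; split; first exact: leq_addr.
    move=> x y Fx Fy; rewrite leNgt; apply/negP => lt; apply: flat.
    by exists x, y; split=> //; split => //; apply: lt_trans lt; rewrite exprn_gt0.
  apply: (@le_trans _ _ eta%:E); last first.
    by rewrite leeDr// mule_ge0 ?diam_pow_ge0// lee_fin ltW.
  rewrite lee_fin exprVn -[leRHS]invrK lef_pV2 ?posrE ?invr_gt0 ?exprn_gt0//.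
  by apply: le_trans mq _; rewrite ler_eXn2l// leq_addl.
have h0 : 0 < 2^-1 :> R by rewrite invr_gt0.
have h1 : 2^-1 < 1 :> R by lra.
have [h0' h1'] := (ltW h0, ltW h1).
have F0 : F !=set0 by exists x.
have xyF := edist_le_diam Fx Fy.
have Dfin : diam F \is a fin_num.
  rewrite fin_numE; apply/andP; split; apply/eqP => D; move: xyF FJ; rewrite D.
    by rewrite leeNy_eq.
  by rewrite leye_eq.
have [D DE] : exists D, diam F = D%:E by exists (fine (diam F)); rewrite fineK.
move: FJ xyF; rewrite DE !lee_fin => DJ xyD.
have D0 : 0 < D by exact: lt_le_trans xyD.
have ex : exists m, 2^-1 ^+ m.+1 < D.
  have [m mH] := @ex_expr_ge 2 D^-1 (ltr1n _ _).
  exists m; rewrite exprVn -[ltRHS]invrK ltf_pV2 ?posrE ?invr_gt0 ?exprn_gt0//.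
  by apply: le_lt_trans mH _; rewrite ltr_eXn2l ?ltr1n.
have [t tD tmin] := ex_minnP ex.
have Dt : D <= 2^-1 ^+ t.
  case: t tmin {tD} => [|u] tmin.
    by apply: le_trans DJ _; rewrite expr0 exprn_ile1.
  by rewrite leNgt; apply/negP => /tmin; rewrite ltnn.
exists t; split.
- rewrite leqNgt; apply/negP => tJ; have := lt_le_trans tD DJ.
  by rewrite ltNge ler_iXn2l// tJ.
- by move=> u v Fu Fv; apply: le_trans Dt; rewrite -lee_fin -DE edist_le_diam.
rewrite diam_pow_nonempty// DE poweR_EFin -EFinM -EFinD lee_fin.
apply: ler_wpDr (ltW eta0) _.
have D1 : D <= 1 by apply: le_trans Dt _; rewrite exprn_ile1.
rewrite -powR_half.
apply: (@le_trans _ _ ((2 * D) `^ (d + k))).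
  apply: ge0_ler_powR.
  - by rewrite addr_ge0// ltW.
  - by rewrite nnegrE exprn_ge0.
  - by rewrite nnegrE mulr_ge0// ltW.
  by rewrite -ler_pdivrMl// -exprS ltW.
rewrite powRM ?(ltW D0)// ler_wpM2l ?powR_ge0//.
by apply: ger_powR; rewrite ?D0//= lerDl ltW.
Qed.

Lemma coord_le_edist {n : nat} (i : 'I_n) (x y : 'rV[R]_n) : `|x 0 i - y 0 i| <= edist x y.
Proof.
rewrite -sqrtr_sqr ler_sqrt; last by apply: sumr_ge0 => k _; exact: sqr_ge0.
by rewrite (bigD1 i)//= lerDl sumr_ge0// => k _; exact: sqr_ge0.
Qed.

(** Past a point where the count is maximal no further index can satisfy [p]. It makes the sets of a
    given scale in a countable cover a finite list. *)
Lemma ex_bound_of_count (p : pred nat) (C : nat) :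
  (forall m, (count p (iota 0 m) <= C)%N) -> exists N, forall k, p k -> (k < N)%N.
Proof.
move=> pC.
have ex : exists v, `[< exists m, count p (iota 0 m) = v >].
  by exists 0%N; apply/asboolP; exists 0%N.
have ub v : `[< exists m, count p (iota 0 m) = v >] -> (v <= C)%N.
  by move=> /asboolP[m <-].
case: (ex_maxnP ex ub) => v /asboolP[N Nv] vmax.
exists N => k pk; rewrite ltnNge; apply/negP => Nk.
suff /vmax : `[< exists m, count p (iota 0 m) = count p (iota 0 k.+1) >].
  rewrite -addn1 iotaD count_cat /= pk -Nv -(subnKC Nk) iotaD count_cat.
  lia.
by apply/asboolP; exists k.+1.
Qed.

(** The coordinates are parameters because steep lines are treated by exchanging them. *)
Definition dyadic_square {n : nat} (t : nat) (i j : 'I_n) (z : 'rV[R]_n) : int * int :=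
  (Num.floor (2 ^+ t * z 0 i), Num.floor (2 ^+ t * z 0 j)).

(** A set of diameter at most 2^-t lies in the 3 by 3 block around the square of any of its points.
    Since the weights q^-t of a cover have a small sum, few of its sets can share a scale; starting
    from covers of diameter at most 2^-J leaves the scales below [J] empty. *)
Lemma dyadic_cover {n : nat} (A : set 'rV[R]_n) (i j : 'I_n) (d k eps : R) (J : nat) :
  0 <= d -> 0 < k -> 0 < eps -> hausdorff_measure d A = 0%E ->
  exists P : nat -> seq (int * int),
    [/\ forall t, uniq (P t), forall t, (t < J)%N -> P t = [::],
        forall z, A z -> exists t, dyadic_square t i j z \in P t &
        forall t, (size (P t))%:R <= eps * (2 `^ (d + k)) ^+ t].
Proof.
move=> d0 k0 eps0 HA.
pose q : R := 2 `^ (d + k).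
have q0 : 0 < q by rewrite powR_gt0.
(* Nine squares per covering set, and total weight at most (q + 1)e: a factor [q] from rounding the
   scales, plus [e] from the summed errors. *)
pose e := eps / (9 * (q + 1)).
have e0 : 0 < e by rewrite divr_gt0// mulr_gt0// addr_gt0.
have J0 : 0 < 2^-1 ^+ J :> R by rewrite exprn_gt0// invr_gt0.
have /ereal_inf_lt[_ [F [AF FJ] <-] Fe] :
    (hausdorff_content d (2^-1 ^+ J) A < e%:E)%E.
  by rewrite ((hausdorff_measure_eq0 _ _).1 HA _ J0) lte_fin.
have /choice[sc scP] : forall m, exists t, [/\ (J <= t)%N,
    forall x y, F m x -> F m y -> edist x y <= 2^-1 ^+ t &
    ((q^-1 ^+ t)%:E <= q%:E * diam_pow d (F m) + (e / (2 ^ m.+1)%:R)%:E)%E].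
  move=> m; apply: ex_dyadic_scale => //.
  by rewrite divr_gt0// ltr0n expn_gt0.
have sum_le m : \sum_(0 <= l < m) q^-1 ^+ sc l <= (q + 1) * e.
  rewrite -lee_fin -sumEFin.
  apply: (@le_trans _ _ (\sum_(0 <= l <oo)
     (q%:E * diam_pow d (F l) + (e / (2 ^ l.+1)%:R)%:E))%E).
    apply: le_trans (nneseries_lim_ge m _).
      by apply: lee_sum => l _; have [_ _] := scP l.
    move=> l _ _; rewrite adde_ge0 ?mule_ge0 ?diam_pow_ge0 ?lee_fin ?(ltW q0)//.
    by rewrite divr_ge0// ltW.
  apply: le_trans (epsilon_trick _ _ (ltW e0)) _.
    by move=> l; rewrite mule_ge0 ?diam_pow_ge0 ?lee_fin ?(ltW q0).
  rewrite nneseriesZl; last by move=> *; exact: diam_pow_ge0.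
  by rewrite mulrDl mul1r EFinD leeD2r// [leRHS]EFinM; apply: lee_wpmul2l; rewrite ?lee_fin ?ltW.
have cnt t m : (count (fun l => sc l == t) (iota 0 m))%:R <= (q + 1) * e * q ^+ t.
  have qt : 0 < q ^+ t by rewrite exprn_gt0.
  rewrite -ler_pdivrMr//; apply: le_trans (sum_le m).
  rewrite -sum1_count natr_sum mulr_suml -/(index_iota 0 m).
  rewrite /index_iota subn0 big_mkcond /=; apply: ler_sum => l _.
  case: eqP => [->|_]; first by rewrite mul1r exprVn.
  by rewrite exprn_ge0// invr_ge0 ltW.
have /choice[N NP] : forall t, exists N, forall l, sc l == t -> (l < N)%N.
  move=> t; apply: (@ex_bound_of_count _ (Num.truncn ((q + 1) * e * q ^+ t))).
  move=> m; rewrite truncn_ge_nat ?cnt//.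
  by rewrite ltW// mulr_gt0 ?exprn_gt0// mulr_gt0// addr_gt0.
(* An empty [F l] gets the default point 0: its nine squares are counted, but have nothing to
   cover. *)
pose pt l := xget 0 (F l).
pose nb (Q : int * int) := [seq (Q.1 + a, Q.2 + b) | a <- [:: -1; 0; 1 : int], b <- [:: -1; 0; 1 : int]].
pose P t := undup (flatten [seq nb (dyadic_square t i j (pt l)) |
                            l <- iota 0 (N t) & sc l == t]).
exists P; split.
- by move=> t; exact: undup_uniq.
- move=> t tJ; rewrite /P (_ : [seq l <- _ | _] = [::])//.
  rewrite (eq_filter (a2 := pred0)) ?filter_pred0// => l.
  by apply/eqP => st; have [] := scP l; rewrite st leqNgt tJ.
- move=> z /AF[l _ Fz]; exists (sc l).
  have Fpt : F l (pt l) by apply: (@xgetPex _ _ (F l)); exists z.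
  have [_ dl _] := scP l.
  have h (u : 'I_n) : Num.floor (2 ^+ sc l * z 0 u) - Num.floor (2 ^+ sc l * pt l 0 u)
      \in [:: -1; 0; 1].
    apply: floor_near; rewrite -mulrBr normrM ger0_norm ?exprn_ge0//.
    rewrite -ler_pdivlMl ?exprn_gt0// mulr1 -exprVn.
    exact: le_trans (coord_le_edist _ _ _) (dl _ _ Fpt Fz).
  rewrite mem_undup; apply/flatten_mapP; exists l.
    by rewrite mem_filter eqxx mem_iota add0n NP.
  apply/allpairsP; exists (Num.floor (2 ^+ sc l * z 0 i) - Num.floor (2 ^+ sc l * pt l 0 i),
    Num.floor (2 ^+ sc l * z 0 j) - Num.floor (2 ^+ sc l * pt l 0 j)); split=> //=.
  by rewrite !(addrC _ (_ - _)) !subrK.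
move=> t; apply: (@le_trans _ _ (9 * ((q + 1) * e * q ^+ t))); last first.
  rewrite le_eqVlt; apply/orP; left; apply/eqP; rewrite /e -/q.
  by field; rewrite gt_eqF// addr_gt0.
apply: le_trans (ler_wpM2l (ler0n _ 9) (cnt t (N t))).
rewrite -natrM ler_nat; apply: leq_trans (size_undup _) _.
rewrite -size_filter size_flatten /shape -map_comp sumnE big_map.
rewrite (eq_bigr (fun=> 9%N)) => [|l _]; last by [].
by rewrite big_const_seq count_predT iter_addn_0.
Qed.

End DyadicCover.

(** * Lines with a large intersection *)

Lemma ord2_eq (i j k : 'I_2) : i != j -> k = i \/ k = j.
Proof.
by case: i j k => [[|[|?]] ?] // [[|[|?]] ?] // [[|[|?]] ?] // _;
  by [left; apply: val_inj | right; apply: val_inj].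
Qed.

Section LineSets.
Context {R : realType} (i j : 'I_2) (ij : i != j).
Implicit Types (z : 'rV[R]_2) (A E : set 'rV[R]_2).

Lemma sum_ord2 (f : 'I_2 -> R) : \sum_(k < 2) f k = f i + f j.
Proof.
rewrite (bigD1 i)//= (bigD1 j) ?(eq_sym j)//= big1 ?addr0// => k.
by have [->|->] := ord2_eq k ij; rewrite eqxx ?andbF.
Qed.

Lemma edist_le_coord z z' : edist z z' <= `|z 0 i - z' 0 i| + `|z 0 j - z' 0 j|.
Proof.
rewrite /Defs.edist sum_ord2 -[leRHS]ger0_norm ?addr_ge0// -sqrtr_sqr ler_sqrt ?sqr_ge0//.
rewrite [leRHS]sqrrD !real_normK ?num_real// -addrA lerD2l lerDr.
by rewrite mulrn_wge0// mulr_ge0.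
Qed.

Definition graph_line (l : R * R) : set 'rV[R]_2 := [set z | z 0 j = l.1 * z 0 i + l.2].

Definition strip (b : R) : set 'rV[R]_2 := [set z | `|z 0 i| <= b].

Lemma dyadic_square_edist t z z' :
  dyadic_square t i j z = dyadic_square t i j z' -> edist z z' <= 2 * 2^-1 ^+ t.
Proof.
move=> [ei ej]; apply: le_trans (edist_le_coord _ _) _.
have p0 : 0 < 2 ^+ t :> R by rewrite exprn_gt0.
have close (u : 'I_2) : Num.floor (2 ^+ t * z 0 u) = Num.floor (2 ^+ t * z' 0 u) ->
    `|z 0 u - z' 0 u| <= 2^-1 ^+ t.
  move=> e; have /andP[a1 a2] := floor_itv (2 ^+ t * z 0 u).
  have /andP[b1 b2] := floor_itv (2 ^+ t * z' 0 u).
  rewrite -e in b1 b2; rewrite intrD in a2 b2.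
  rewrite exprVn -[leRHS]mulr1 ler_pdivlMl// -[X in X * _]gtr0_norm// -normrM mulrBr.
  by rewrite ler_norml; apply/andP; split; lra.
by rewrite mulrDl mul1r lerD ?close.
Qed.

(* If the squares of [P] that meet [A] were too few at every scale, they would
   form a cheap cover of [A]. *)
Lemma ex_rich_scale A (P : nat -> seq (int * int)) (s k mu : R) (c : nat) :
  0 <= s -> 0 < k -> 0 < mu ->
  (forall z, A z -> exists t, dyadic_square t i j z \in P t) ->
  (forall t, (t < c.+1)%N -> P t = [::]) ->
  (mu%:E <= hausdorff_content s (2^-1 ^+ c) A)%E ->
  exists t, mu / 2 * (1 - 2 `^ (- k)) / 2 `^ s * (2 `^ (s - k)) ^+ t <=
    (count (fun Q => `[< exists2 z, A z & dyadic_square t i j z = Q >]) (P t))%:R.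
Proof.
move=> s0 k0 mu0 AP Pc muA; apply: contrapT => /forallNP rich.
pose p t Q := `[< exists2 z, A z & dyadic_square t i j z = Q >].
set z := 2 `^ (- k) in rich.
have z0 : 0 <= z < 1.
  rewrite powR_ge0/= /z -[ltRHS](powRr0 (2 : R)) /powR !gt_eqF// ltr_expR.
  by rewrite ltr_pM2r ?ln_gt0 ?ltr1n// oppr_lt0.
have z1 : 0 < 1 - z by have /andP[_] := z0; rewrite subr_gt0.
have s20 : 0 < 2 `^ s :> R by rewrite powR_gt0.
(* Scale [t] is allotted the share a * 2^(-kt) of the content; the shares sum to mu / 2, which
   contradicts the lower bound [mu]. The 2^s in the threshold pays for the diameter bound 2 * 2^-t
   of a square. *)
pose a := mu / 2 * (1 - z).
have a0 : 0 <= a by rewrite mulr_ge0 ?divr_ge0// ltW.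
suff : (hausdorff_content s (2^-1 ^+ c) A <= (a / (1 - z))%:E)%E.
  move=> /(le_trans muA); rewrite lee_fin /a mulfK ?gt_eqF//.
  by rewrite leNgt ltr_pdivrMr// ltr_pMr// ltr1n.
apply: le_trans (nneseries_geometric_le a0 z0).
pose At t := A `&` [set w | dyadic_square t i j w \in P t].
apply: (@le_trans _ _ (hausdorff_content s (2^-1 ^+ c) (\bigcup_t At t))).
  by apply: hausdorff_content_mono => // w Aw; have [t] := AP w Aw; exists t.
apply: le_trans (hausdorff_content_bigcup _ _ _) _.
apply: lee_nneseries => t _; first by move=> _; exact: hausdorff_content_ge0.
have [tc|ct] := ltnP t c.+1.
  rewrite (_ : At t = set0) ?hausdorff_content_set0.
    by rewrite lee_fin mulr_ge0// exprn_ge0//; case/andP: z0.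
  by apply/seteqP; split=> // w [_] /=; rewrite Pc.
pose AQ Q := A `&` [set w | dyadic_square t i j w = Q].
apply: (@le_trans _ _ (hausdorff_content s (2^-1 ^+ c)
    (\bigcup_(Q in [set Q | (Q \in P t) && p t Q]) AQ Q))).
  apply: hausdorff_content_mono => // w [Aw /= Pw].
  by exists (dyadic_square t i j w) => //=; rewrite Pw; apply/asboolP; exists w.
apply: le_trans (hausdorff_content_bigcup_seq _ _ _ _ _) _.
(* Here the emptiness of [P t] up to [t = c] matters: the remaining squares are small enough for the
   content at scale 2^-c. *)
have ht : 2 * 2^-1 ^+ t <= 2^-1 ^+ c :> R.
  rewrite -(prednK (leq_ltn_trans (leq0n c) ct)) exprS mulrA divff ?mul1r ?pnatr_eq0//.
  rewrite ler_iXn2l ?invr_gt0 ?invf_lt1 ?ltr1n//.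
  by rewrite -ltnS (ltn_predK ct).
apply: (@le_trans _ _ (\sum_(Q <- P t | p t Q) ((2 * 2^-1 ^+ t) `^ s)%:E)).
  apply: lee_sum => Q _; apply: hausdorff_content_le_pow => //.
  by move=> w w' [_ /= wQ] [_ /= w'Q]; apply: dyadic_square_edist; rewrite wQ.
rewrite sumEFin big_const_seq iter_addr_0 lee_fin -[leLHS]mulr_natr.
have := rich t => /negP; rewrite -ltNge => /ltW lt.
rewrite powRM ?exprn_ge0 ?invr_ge0// powR_half.
apply: le_trans (ler_wpM2l _ lt) _.
  by rewrite mulr_ge0 ?powR_ge0// exprn_ge0// invr_ge0 ltW.
rewrite le_eqVlt; apply/orP; left; apply/eqP.
have -> : z ^+ t = (2 `^ s)^-1 ^+ t * (2 `^ (s - k)) ^+ t.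
  rewrite -exprMn /z [s - k]addrC powRD ?pnatr_eq0 ?implybT//.
  by rewrite mulrCA mulVf ?mulr1 ?gt_eqF.
move: (_ ^+ t) (_ ^+ t) => u v; rewrite /a.
by field; rewrite gt_eqF.
Qed.

Lemma ex_nat_shift (k : int) (a b : nat) : - a%:Z <= k -> k <= b%:Z ->
  exists2 m : nat, (m < a + b + 1)%N & k = m%:Z - a%:Z.
Proof. by move=> ak kb; exists `|(k + a%:Z)%R|%N; lia. Qed.

(* [hits] lives in the plane rescaled by [2^t], where the dyadic squares of side
   [2^-t] become unit squares. *)
Definition scale_points (G : set (R * R)) (P : seq (int * int)) (t c : nat) (M : R)
    : set 'rV[R]_2 :=
  [set z | strip (2 ^+ c) z /\ exists l, [/\ G l, graph_line l z &
     M <= (count (hits (2 ^ (t + c))%N (l.1, 2 ^+ t * l.2)) P)%:R]].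

(** The strip consists of at most 4B columns of width 2^-t. In each, [slice_count] on the left edge
    bounds the number of cells crossed by rich lines, and every cell has diameter at most 4 *
    2^-t. *)
Lemma content_rich_scale_le (G : set (R * R)) (P : seq (int * int)) (t c : nat)
    (M r delta : R) :
  uniq P -> 0 < M -> 0 <= r -> 4 * 2^-1 ^+ t <= delta ->
  (forall l, G l -> `|l.1| <= 1 /\ `|l.2| <= 2 ^+ c) ->
  (hausdorff_content r delta (scale_points G P t c M)
   <= (4 * (2 ^ (t + c))%N%:R * (672 * (2 ^ (t + c))%N%:R * (size P)%:R
         * harmonic_sum (8 * 2 ^ (t + c))%N / M ^+ 2 * (4 * 2^-1 ^+ t) `^ r))%R%:E)%E.
Proof.
move=> uP M0 r0 td HG; set Z := scale_points G P t c M.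
pose B := (2 ^ (t + c))%N; rewrite -/B.
have B0 : (0 < B)%N by rewrite expn_gt0.
have B1 : 1 <= B%:R :> R by rewrite ler1n.
have BE : B%:R = 2 ^+ t * 2 ^+ c :> R by rewrite natrX exprD.
have t0 : 0 < 2 ^+ t :> R by rewrite exprn_gt0.
pose kz (m : nat) : int := m%:Z - B.+1%:Z.
pose col m := [set z : 'rV[R]_2 | Num.floor (2 ^+ t * z 0 i) = kz m].
pose v m (l : R * R) : R := l.1 * (kz m)%:~R + 2 ^+ t * l.2.
pose rich (l : R * R) := M <= (count (hits B (l.1, 2 ^+ t * l.2)) P)%:R.
(* A cell records where the line crosses the left edge of the column, not the height of the point.
   Slope at most 1 keeps the point within 1 of that crossing, so in units of 2^-t a cell has width
   at most 1 and height at most 3. *)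
pose cell m (q : 'I_(8 * B)%N) := [set z : 'rV[R]_2 | col m z /\ exists l,
  [/\ G l, graph_line l z & Num.floor (v m l) = q%:Z - (4 * B)%:Z]].
pose J m (q : 'I_(8 * B)%N) := `[< exists l,
  [/\ G l, rich l & Num.floor (v m l) = q%:Z - (4 * B)%:Z] >].
have near_v m l z : `|l.1| <= 1 -> graph_line l z -> col m z ->
    `|2 ^+ t * z 0 j - v m l| <= 1.
  move=> l1 -> zk; have /andP[] := floor_itv (2 ^+ t * z 0 i); rewrite zk intrD => a1 a2.
  have -> : 2 ^+ t * (l.1 * z 0 i + l.2) - v m l = l.1 * (2 ^+ t * z 0 i - (kz m)%:~R).
    by rewrite /v; ring.
  rewrite normrM -[leRHS]mulr1 ler_pM// ler_norml; apply/andP; split; lra.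
have cell_edist m q z z' : cell m q z -> cell m q z' -> edist z z' <= 4 * 2^-1 ^+ t.
  move=> [zk [l [Gl lz lq]]] [zk' [l' [Gl' lz' lq']]].
  apply: le_trans (edist_le_coord _ _) _.
  rewrite exprVn -ler_pdivrMr ?invr_gt0// invrK mulrC mulrDr.
  rewrite -[X in X * `|_ - _| + _]gtr0_norm// -[X in _ + X * _]gtr0_norm// -!normrM !mulrBr.
  have := near_v _ _ _ (HG _ Gl).1 lz zk; have := near_v _ _ _ (HG _ Gl').1 lz' zk'.
  rewrite ler_norml => /andP[n1 n2]; rewrite ler_norml => /andP[n3 n4].
  have /andP[] := floor_itv (2 ^+ t * z 0 i); rewrite zk intrD => a1 a2.
  have /andP[] := floor_itv (2 ^+ t * z' 0 i); rewrite zk' intrD => b1 b2.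
  have /andP[] := floor_itv (v m l); rewrite lq intrD => c1 c2.
  have /andP[] := floor_itv (v m l'); rewrite lq' intrD => d1 d2.
  have : `|2 ^+ t * z 0 i - 2 ^+ t * z' 0 i| <= 1.
    by rewrite ler_norml; apply/andP; split; lra.
  have : `|2 ^+ t * z 0 j - 2 ^+ t * z' 0 j| <= 3.
    by rewrite ler_norml; apply/andP; split; lra.
  lra.
have cover : Z `<=` \bigcup_(m in [set m | (m \in iota 0 (2 * B + 2)%N) && true]) (Z `&` col m).
  move=> z [zs Zz]; set x := 2 ^+ t * z 0 i.
  have xB : `|x| <= B%:R by rewrite BE normrM gtr0_norm// ler_pM2l.
  have /andP[x1 x2] := floor_itv x; rewrite intrD in x2.
  move: xB; rewrite ler_norml => /andP[xB1 xB2].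
  have k1 : - (B%:Z) <= Num.floor x by rewrite floor_ge_int intrN.
  have k2 : Num.floor x <= B%:Z.
    by rewrite -(ler_int R); apply: le_trans x1 _.
  have [|m mB mk] := @ex_nat_shift _ B.+1 B _ k2.
    by apply: le_trans k1; rewrite lerN2 lez_nat.
  exists m; last by split.
  by rewrite /= mem_iota andbT add0n (leq_trans mB)// addn1 addSn addn2 mul2n addnn.
have kB m : (m < 2 * B + 2)%N -> `|(kz m)%:~R| <= B%:R + 1 :> R.
  rewrite -ltnS addn2 !ltnS -(ler_nat R) -natr1 natrM => mB.
  have -> : (kz m)%:~R = m%:R - (B%:R + 1) :> R by rewrite natr1 intrB.
  by rewrite ler_norml; apply/andP; split; have := ler0n R m; lra.
have col_cover m : (m \in iota 0 (2 * B + 2)%N) -> Z `&` col m `<=`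
    \bigcup_(q in [set q | (q \in index_enum 'I_(8 * B)%N) && J m q]) cell m q.
  rewrite mem_iota add0n => mB z [[zs [l [Gl lz lr]]] zk].
  have [l1 l2] := HG _ Gl.
  have kmB := kB _ mB.
  (* B + 1 <= 2B from the slope term and [B] from the intercept; the 8B cells, of heights from -4B
     to 4B, therefore contain every crossing. *)
  have vB : `|v m l| <= 3 * B%:R.
    apply: le_trans (ler_normD _ _) _; rewrite !normrM (gtr0_norm t0).
    have : 2 ^+ t * `|l.2| <= B%:R by rewrite BE ler_pM2l.
    have : `|l.1| * `|(kz m)%:~R| <= 1 * (B%:R + 1) by rewrite ler_pM.
    lra.
  move: vB; rewrite ler_norml => /andP[v1 v2].
  have f1 : - ((3 * B)%:Z) <= Num.floor (v m l).
    by rewrite floor_ge_int intrN -pmulrn natrM.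
  have f2 : Num.floor (v m l) <= (3 * B)%:Z.
    by rewrite -(ler_int R); apply: le_trans (floor_le _) _; rewrite -[leRHS]pmulrn natrM.
  have [|q qB qE] := @ex_nat_shift _ (4 * B) (3 * B) _ f2.
    by apply: le_trans f1; rewrite lerN2 lez_nat leq_mul2r orbT.
  have qP : (q < 8 * B)%N.
    by rewrite (leq_trans qB)// -mulnDl addn1 ltn_mul2r B0.
  exists (Ordinal qP); last by split => //; exists l.
  by rewrite /= mem_index_enum; apply/asboolP; exists l.
have H0 : 0 <= harmonic_sum (8 * B)%N :> R by apply: sumr_ge0.
have rho0 : 0 <= (4 * 2^-1 ^+ t) `^ r :> R by exact: powR_ge0.
have colJ m : (m \in iota 0 (2 * B + 2)%N) -> M ^+ 2 * #|J m|%:R <=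
    672 * B%:R * (size P)%:R * harmonic_sum (8 * B)%N.
  rewrite mem_iota add0n => mB.
  have /choice[l lP] : forall q : 'I_(8 * B)%N, exists l : R * R, J m q ->
      [/\ G l, rich l & Num.floor (v m l) = q%:Z - (4 * B)%:Z].
    move=> q; have [|nJ] := boolP (J m q); last by exists (0, 0).
    by move=> /asboolP[l lP]; exists l.
  apply: (@slice_count _ B (kz m)%:~R M P (J m) (fun q => ((l q).1, 2 ^+ t * (l q).2))) => //.
  - exact: kB.
  - exact: ltW.
  - by move=> q /lP[Gl lr lq]; split => //; have [] := HG _ Gl.
apply: le_trans (hausdorff_content_mono _ cover (lexx _)) _.
apply: le_trans (hausdorff_content_bigcup_seq _ _ _ _ _) _.
set K := 672 * B%:R * (size P)%:R * harmonic_sum (8 * B)%N in colJ *.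
have K0 : 0 <= K by rewrite /K !mulr_ge0 ?ler0n.
apply: (@le_trans _ _ (\sum_(m <- iota 0 (2 * B + 2)%N) (K / M ^+ 2 * (4 * 2^-1 ^+ t) `^ r)%:E)%E).
  rewrite big_seq [leRHS]big_seq; apply: lee_sum => m mB.
  apply: le_trans (hausdorff_content_mono _ (col_cover m mB) (lexx _)) _.
  apply: le_trans (hausdorff_content_bigcup_seq _ _ _ _ _) _.
  apply: (@le_trans _ _ (\sum_(q | J m q) ((4 * 2^-1 ^+ t) `^ r)%:E)%E).
    by apply: lee_sum => q _; apply: hausdorff_content_le_pow => //; exact: cell_edist.
  rewrite sumEFin lee_fin (eq_bigl (fun q => q \in J m))// sumr_const.
  rewrite -[leLHS]mulr_natl ler_wpM2r// ler_pdivlMr ?exprn_gt0//.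
  by rewrite mulrC colJ.
rewrite sumEFin lee_fin big_const_seq count_predT size_iota iter_addr_0.
rewrite -[leLHS]mulr_natl ler_wpM2r//.
  by rewrite mulr_ge0// divr_ge0// exprn_ge0// ltW.
by rewrite natrD natrM; lra.
Qed.

(** One stratum: the single parameter [c] bounds the intercept, the window, the cover scale and the
    content, so that all constants below are uniform over its lines. *)
Definition rich_lines E (s : R) (c : nat) : set (R * R) :=
  [set l | [/\ `|l.1| <= 1, `|l.2| <= 2 ^+ c &
     ((2^-1 ^+ c)%:E
        <= hausdorff_content s (2^-1 ^+ c) (E `&` graph_line l `&` strip (2 ^+ c)))%E]].

Definition rich_points E (s : R) (c : nat) : set 'rV[R]_2 :=
  [set z | strip (2 ^+ c) z /\ exists2 l, rich_lines E s c l & graph_line l z].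

(** Used with x = 2^k to absorb the logarithm into an arbitrarily small power of the scale. *)
Lemma linear_le_geometric (x : R) (a : nat) : 1 < x ->
  exists2 D, 0 <= D & forall t, (t + a)%:R <= D * x ^+ t.
Proof.
move=> x1; have x0 : 0 < x - 1 by rewrite subr_gt0.
exists ((x - 1)^-1 + a%:R) => [|t]; first by rewrite addr_ge0// invr_ge0 ltW.
rewrite natrD mulrDl lerD//.
  rewrite -ler_pdivrMl ?invr_gt0// invrK mulrC.
  by apply: le_trans (bernoulli t (ltW x1)); rewrite lerDr.
by rewrite ler_peMr// exprn_ege1// ltW.
Qed.

Lemma scale_points_subset E (P : nat -> seq (int * int)) (s k : R) (c : nat) :
  0 <= s -> 0 < k ->
  (forall z, E z -> exists t, dyadic_square t i j z \in P t) ->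
  (forall t, (t < c.+1)%N -> P t = [::]) ->
  rich_points E s c `<=` \bigcup_t scale_points (rich_lines E s c) (P t) t c
    (2^-1 ^+ c / 2 * (1 - 2 `^ (- k)) / 2 `^ s * (2 `^ (s - k)) ^+ t).
Proof.
move=> s0 k0 EP Pc z [zs [l Gl lz]].
have c0 : 0 < 2^-1 ^+ c :> R by rewrite exprn_gt0// invr_gt0.
have [l1 l2 lc] := Gl.
have [|t tM] := ex_rich_scale s0 k0 c0 _ Pc lc.
  by move=> w [[Ew _] _]; exact: EP.
exists t => //; split => //; exists l; split => //.
apply: le_trans tM _; rewrite ler_nat; apply: sub_count => Q /asboolP[w [[_ lw] ws] <-].
apply/asboolP; exists (2 ^+ t * w 0 i); split => //=.
  by rewrite normrM gtr0_norm ?exprn_gt0// natrX exprD ler_pM2l ?exprn_gt0.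
by rewrite lw; congr Num.floor; ring.
Qed.

(** The content bound at each scale is linear in the number of squares, which carries the factor
    [eps], and the scales sum to a convergent geometric series. So the content is at most a multiple
    of [eps], with a constant that does not depend on the cover. *)
Lemma rich_points_null E (d s k : R) (c : nat) :
  0 <= d -> 0 < k -> k <= s -> s <= 1 -> hausdorff_measure d E = 0%E ->
  hausdorff_measure (d + (2 - 2 * s) + 7 * k) (rich_points E (s - k) c) = 0%E.
Proof.
move=> d0 k0 ks s1 HE; set r := d + _ + _.
have r0 : 0 <= r by rewrite /r; lra.
have sk0 : 0 <= s - k by lra.
apply/hausdorff_measure_eq0 => delta delta0.
pose p (x : R) : R := 2 `^ x.
have p0 x : 0 < p x by rewrite powR_gt0.
have pD x y : p x * p y = p (x + y) by rewrite -powRD// pnatr_eq0 implybT.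
have p1 x : 0 < x -> 1 < p x.
  move=> x0; rewrite -[ltLHS](powRr0 (2 : R)) /p /powR !gt_eqF// ltr_expR.
  by rewrite ltr_pM2r ?ln_gt0 ?ltr1n.
have z1 : p (- k) < 1.
  by rewrite /p powRN invf_lt1 ?p1// p0.
have z1' : 0 < 1 - p (- k) by rewrite subr_gt0.
pose M0 := 2^-1 ^+ c / 2 * (1 - p (- k)) / p (s - k).
have M00 : 0 < M0.
  by rewrite /M0 !mulr_gt0// ?invr_gt0// exprn_gt0// invr_gt0.
pose M t := M0 * p (s - k - k) ^+ t.
have Mt0 t : 0 < M t by rewrite mulr_gt0// exprn_gt0.
have [D D0 HD] := linear_le_geometric (c + 4) (p1 _ k0).
have [C CE C0] : exists2 C : R, C = 4 * 672 & 0 <= C.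
  exists (4 * 672); first reflexivity.
  exact: mulr_ge0 (ler0n _ _) (ler0n _ _).
have [K KE K0] : exists2 K, K = C * (2 ^+ c) ^+ 2 * D / M0 ^+ 2 * 4 `^ r & 0 <= K.
  eexists; first by [].
  exact: mulr_ge0 (divr_ge0 (mulr_ge0 (mulr_ge0 C0 (sqr_ge0 _)) D0) (sqr_ge0 _)) (powR_ge0 _ _).
suff main eps : 0 < eps -> (hausdorff_content r delta (rich_points E (s - k) c)
    <= (eps * K / (1 - p (- k)))%:E)%E.
  apply/eqP; rewrite eq_le hausdorff_content_ge0 andbT.
  apply/lee_addgt0Pr => e e0; rewrite add0e.
  pose K1 := K / (1 - p (- k)) + 1.
  have K10 : 0 < K1 by rewrite ltr_wpDl// divr_ge0// ltW.
  apply: le_trans (main (e / K1) (divr_gt0 e0 K10)) _.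
  rewrite lee_fin -mulrA -mulrA ger_pMr// mulrC ler_pdivrMr// mul1r.
  by rewrite /K1 lerDl.
move=> eps0.
(* Cells of diameter 4 * 2^-t are admissible for [delta] once [t >= m]; coarser scales are removed
   by starting the dyadic cover beyond [m]. *)
have [m mdelta] := ex_expr_ge (4 / delta) (ltr1n R 2 : 1 < 2).
have [P [uP PJ EP szP]] := dyadic_cover i j (c.+1 + m) d0 k0 eps0 HE.
have Pc t : (t < c.+1)%N -> P t = [::] by move=> tc; apply: PJ; rewrite ltn_addr.
apply: le_trans (hausdorff_content_mono _ (scale_points_subset sk0 k0 EP Pc) (lexx _)) _.
apply: le_trans (hausdorff_content_bigcup _ _ _) _.
have zz : 0 <= p (- k) < 1 by rewrite z1 andbT ltW.
apply: le_trans (nneseries_geometric_le (mulr_ge0 (ltW eps0) K0) zz).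
apply: lee_nneseries => t _; first by move=> _; exact: hausdorff_content_ge0.
rewrite -/(M t).
have [tJ|Jt] := ltnP t (c.+1 + m).
  rewrite PJ// (_ : scale_points _ _ _ _ _ = set0) ?hausdorff_content_set0.
    by rewrite lee_fin !mulr_ge0 ?exprn_ge0// ltW.
  apply/seteqP; split=> // w [_ [l [_ _]]] /=; rewrite leNgt.
  by rewrite -/(p _) -/(p _) -/M0 (Mt0 t).
have delta_t : 4 * 2^-1 ^+ t <= delta.
  have : 4 / delta <= 2 ^+ t.
    apply: le_trans mdelta _; rewrite ler_eXn2l ?ltr1n//.
    exact: leq_trans (leq_addl _ _) Jt.
  by rewrite exprVn ler_pdivrMr// ler_pdivrMr ?exprn_gt0// mulrC.
apply: le_trans (content_rich_scale_le (uP t) (Mt0 t) r0 delta_t _) _.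
  by move=> l [].
rewrite lee_fin.
have Bt : (2 ^ (t + c))%N%:R = 2 ^+ t * 2 ^+ c :> R by rewrite natrX exprD.
have Ht : harmonic_sum (8 * 2 ^ (t + c))%N <= D * p k ^+ t.
  rewrite -[8%N]/(2 ^ 3)%N -expnD; apply: le_trans (harmonic_sum_pow2 _) _.
  by apply: le_trans (HD t); rewrite ler_nat [leqRHS]addnA [leqRHS]addnC.
have H0 : 0 <= harmonic_sum (8 * 2 ^ (t + c))%N :> R by apply: sumr_ge0.
rewrite Bt powRM ?exprn_ge0 ?invr_ge0// powR_half.
(* The balance of exponents 2 + (d + k) + k = -k + 2(s - 2k) + r, which fixes [r]. Of the 7k, one
   [k] each comes from the cover, the logarithm and the convergence over scales, and 4k from the
   squared richness 2^(t(s-2k)). *)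
have ident : 2 ^+ t * 2 ^+ t * p (d + k) ^+ t * p k ^+ t =
    p (- k) ^+ t * (p (s - k - k) ^+ t) ^+ 2 * p r ^+ t.
  rewrite [(_ ^+ t) ^+ 2]exprAC -!exprMn; congr (_ ^+ _).
  have -> : 2 = p 1 by rewrite /p powRr1.
  by rewrite expr2 !pD; congr p; rewrite /r; ring.
have sz0 : 0 <= (size (P t))%:R :> R by [].
have := szP t; rewrite -/(p _).
move: (size (P t))%:R (harmonic_sum _) H0 Ht sz0 ident => N H H0 Ht N0 ident NX.
rewrite -/(p r) /M KE exprVn.
have pt x : p x ^+ t != 0 by rewrite gt_eqF// exprn_gt0.
have hM : p (s - k - k) ^+ t != 0 by [].
apply: (@le_trans _ _ (C * (2 ^+ t * 2 ^+ c) ^+ 2 / (M0 * p (s - k - k) ^+ t) ^+ 2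
    * (4 `^ r * (p r ^+ t)^-1) * (eps * p (d + k) ^+ t * (D * p k ^+ t)))).
  rewrite (_ : 4 * _ * _ = C * (2 ^+ t * 2 ^+ c) ^+ 2 / (M0 * p (s - k - k) ^+ t) ^+ 2
    * (4 `^ r * (p r ^+ t)^-1) * (N * H)); last by rewrite CE; ring.
  apply: ler_wpM2l; last exact: ler_pM.
  apply: mulr_ge0 (divr_ge0 (mulr_ge0 C0 (sqr_ge0 _)) (sqr_ge0 _)) (mulr_ge0 (powR_ge0 _ _) _).
  by rewrite invr_ge0 exprn_ge0// ltW.
rewrite le_eqVlt; apply/orP; left; apply/eqP.
rewrite (_ : C * _ / _ * _ * _ = C * (2 ^+ c) ^+ 2 * D / M0 ^+ 2 * 4 `^ r * eps *
   (2 ^+ t * 2 ^+ t * p (d + k) ^+ t * p k ^+ t) /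
   ((p (s - k - k) ^+ t) ^+ 2 * p r ^+ t)); last first.
  by field; rewrite pt pt gt_eqF.
rewrite ident; field.
by rewrite pt pt gt_eqF.
Qed.

End LineSets.

(** * The extension *)

Section Extension.
Context {R : realType}.
Implicit Types (E l : set 'rV[R]_2).

(** Dividing by the larger coordinate of the direction gives a slope of modulus at most 1. *)
Lemma affine_line_graph l : affine_lines l ->
  exists (i j : 'I_2) (ab : R * R),
    [/\ i != j, `|ab.1| <= 1 & l `<=` graph_line i j ab].
Proof.
move=> [x [v [v0 ->]]].
have [i [j [ij vi vij]]] : exists i j : 'I_2, [/\ i != j, v 0 i != 0 & `|v 0 j| <= `|v 0 i|].
  pose i0 := ord0 : 'I_2; pose i1 := lift ord0 ord0 : 'I_2.
  have h i j : i != j -> `|v 0 j| <= `|v 0 i| -> v 0 i != 0.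
    move=> ij vij; apply: contra v0 => /eqP vi0.
    move: vij; rewrite vi0 normr0 normr_le0 => /eqP vj0.
    apply/eqP/rowP => k; rewrite mxE.
    by have [->|->] := ord2_eq k ij.
  have [le|/ltW le] := leP `|v 0 i1| `|v 0 i0|.
    by exists i0, i1; split=> //; exact: (h _ i1).
  by exists i1, i0; split=> //; exact: (h _ i0).
exists i, j, (v 0 j / v 0 i, x 0 j - v 0 j / v 0 i * x 0 i); split => //=.
  by rewrite normrM normfV ler_pdivrMr ?mul1r// normr_gt0.
by move=> _ [t _ <-]; rewrite /graph_line /= !mxE; field.
Qed.

(** Below the dimension the measure is positive, hence by countable subadditivity so is the content
    of a bounded part at some [delta]. All the conditions defining a stratum then persist as [c]
    grows, which leaves room to enlarge [c] until the window contains a given point of the line. *)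
Lemma rich_lines_of_dim E l (i j : 'I_2) (ab : R * R) (s k : R) :
  0 < k -> k <= s -> `|ab.1| <= 1 -> l `<=` graph_line i j ab ->
  (s%:E <= hausdorff_dim (l `&` E))%E ->
  exists c0, forall c, (c0 <= c)%N -> rich_lines i j E (s - k) c ab.
Proof.
move=> k0 ks a1 lab sdim.
have sk0 : 0 <= s - k by rewrite subr_ge0.
have pos : hausdorff_measure (s - k) (l `&` E) <> 0%E.
  move=> /(hausdorff_dim_le sk0) /(le_trans sdim); rewrite lee_fin; lra.
pose A c := l `&` E `&` strip i (2 ^+ c : R).
have two1 : 1 < 2 :> R by rewrite ltr1n.
have [c1 /eqP Ac1] : exists c1, hausdorff_measure (s - k) (A c1) != 0%E.
  apply: contrapT => /forallNP h; apply: pos.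
  apply: (@hausdorff_measure_sub_eq0 _ _ _ _ (\bigcup_c A c)).
    move=> z Ez; have [c zc] := ex_expr_ge `|z 0 i| two1.
    by exists c.
  by apply: hausdorff_measure_bigcup_eq0 => c; have /negP := h c; rewrite negbK => /eqP.
have [delta delta0 cpos] : exists2 delta, 0 < delta &
    (0 < hausdorff_content (s - k) delta (A c1))%E.
  apply: contrapT => h; apply: Ac1; apply/hausdorff_measure_eq0 => delta delta0.
  apply/eqP; rewrite eq_le hausdorff_content_ge0 andbT leNgt.
  by apply/negP => ?; apply: h; exists delta.
have [mu mu0 muc] : exists2 mu : R, 0 < mu &
    (mu%:E <= hausdorff_content (s - k) delta (A c1))%E.
  case: (hausdorff_content _ _ _) cpos => [x|_|//]; last by exists 1; rewrite ?leey.
  by rewrite lte_fin => x0; exists x.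
have [c2 c2P] := ex_expr_ge delta^-1 two1.
have [c3 c3P] := ex_expr_ge mu^-1 two1.
have [c4 c4P] := ex_expr_ge `|ab.2| two1.
have up (a b : nat) : (a <= b)%N -> 2 ^+ a <= 2 ^+ b :> R.
  by move=> ab'; rewrite ler_eXn2l.
have inv_le (x : R) (a b : nat) : 0 < x -> x^-1 <= 2 ^+ a -> (a <= b)%N -> 2^-1 ^+ b <= x.
  move=> x0 xa leab; rewrite exprVn -[leRHS]invrK lef_pV2 ?posrE ?invr_gt0 ?exprn_gt0//.
  exact: le_trans xa (up _ _ leab).
exists (c1 + c2 + c3 + c4)%N => c hc; split => //.
  by apply: le_trans c4P (up _ _ _); apply: leq_trans hc; exact: leq_addl.
apply: le_trans (le_trans muc _).
  rewrite lee_fin; apply: inv_le mu0 c3P _; apply: leq_trans hc.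
  by rewrite addnAC leq_addl.
apply: hausdorff_content_mono.
  move=> z [[lz Ez] sz]; split; first by split => //; exact: lab.
  by apply: le_trans sz (up _ _ _); apply: leq_trans hc; rewrite -!addnA leq_addr.
apply: inv_le delta0 c2P _; apply: leq_trans hc.
by rewrite -!addnA addnCA leq_addr.
Qed.

Lemma hausdorff_dim_extension_le (s : R) E : 0 < s <= 1 ->
  (hausdorff_dim (hausdorff_extension s E) <= hausdorff_dim E + (2 - 2 * s)%:E)%E.
Proof.
move=> /andP[s0 s1]; rewrite -leeBlDr//; apply: le_ereal_inf_tmp => _ [d [d0 HE] <-].
rewrite leeBlDr// -EFinD; apply/lee_addgt0Pr => e e0.
(* The 7 matches the loss in [rich_points_null]; [k <= s] keeps the dimension [s - k]
   nonnegative. *)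
pose k := Num.min s (e / 7).
have k0 : 0 < k by rewrite /k lt_min s0 divr_gt0.
have ks : k <= s by rewrite /k ge_min lexx.
have k7 : 7 * k <= e.
  have : k <= e / 7 by rewrite /k ge_min lexx orbT.
  by rewrite ler_pdivlMr// mulrC.
apply: (@le_trans _ _ (d + (2 - 2 * s) + 7 * k)%:E); last first.
  by rewrite -EFinD lee_fin lerD2l.
apply: hausdorff_dim_le; first by lra.
pose coord (b : bool) : 'I_2 := if b then ord0 else lift ord0 ord0.
(* One index enumerates all strata: the parity of [m] selects the order of the coordinates and
   [m./2] is [c]. *)
pose F (m : nat) := rich_points (coord (odd m)) (coord (~~ odd m)) E (s - k) m./2.
apply: (@hausdorff_measure_sub_eq0 _ _ _ _ (\bigcup_m F m)); last first.
  apply: hausdorff_measure_bigcup_eq0 => m; apply: rich_points_null => //.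
  by case: (odd m).
move=> z [l [/affine_line_graph[i [j [ab [ij a1 lab]]]] sdim] lz].
have [c0 c0P] := rich_lines_of_dim k0 ks a1 lab sdim.
have [c1 c1P] := ex_expr_ge `|z 0 i| (ltr1n R 2 : 1 < 2).
pose c := (c0 + c1)%N.
have rz : rich_points i j E (s - k) c z.
  split; last by exists ab; [apply: c0P; exact: leq_addr|exact: lab].
  by apply: le_trans c1P _; rewrite ler_eXn2l ?ltr1n// leq_addl.
pose b := i == ord0.
have [iE jE] : i = coord b /\ j = coord (~~ b).
  rewrite /b; case: i j ij {sdim lab rz lz c0P c1P b} => [[|[|?]] ?] // [[|[|?]] ?] // _;
    by split; apply: val_inj.
exists (b + c.*2)%N => //; rewrite /F oddD odd_double addbF oddb half_bit_double.
by rewrite -iE -jE.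
Qed.

Lemma powR_le1_ge (x r : R) : 0 <= x <= 1 -> r <= 1 -> x <= x `^ r.
Proof.
move=> /andP[x0 x1] r1; have [->|xn0] := eqVneq x 0; first exact: powR_ge0.
have xpos : 0 < x by rewrite lt_neqAle eq_sym xn0.
by rewrite -[leLHS]powRr1//; apply: ger_powR; rewrite ?xpos.
Qed.

(* The projection of a cover of [S] to the coordinate [i] covers an interval,
   so by subadditivity of Lebesgue measure its diameters cannot sum to
   arbitrarily small values. *)
Lemma hausdorff_dim_segment_ge1 {n : nat} (S : set 'rV[R]_n) :
  line_segments S -> (1%:E <= hausdorff_dim S)%E.
Proof.
move=> [x [y [xy SE]]].
have [i xyi] : exists i, x 0 i != y 0 i.
  apply: contrapT => /forallNP h; move/eqP: xy; apply; apply/rowP => i.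
  by have /negP := h i; rewrite negbK => /eqP.
apply: le_ereal_inf_tmp => _ [r [r0 Hr] <-]; rewrite lee_fin leNgt; apply/negP => r1.
pose h := `|y 0 i - x 0 i|.
have h0 : 0 < h by rewrite normr_gt0 subr_eq0 eq_sym.
have S0 : S !=set0.
  by rewrite SE; exists x; exists 0; rewrite /= ?in_itv /= ?lexx ?ler01// subr0 scale1r scale0r addr0.
(* Scale 1 keeps all diameters at most 1, where [r < 1] gives diam <= diam^r. The intervals below
   are twice as long as the diameters, so h / 4 makes their total length less than h / 2. *)
have /ereal_inf_lt[_ [F [SF Fd] <-] Fe] : (hausdorff_content r 1 S < (h / 4)%:E)%E.
  by rewrite ((hausdorff_measure_eq0 _ _).1 Hr)// lte_fin divr_gt0.
pose dm k := if F k == set0 then 0 else fine (diam (F k)).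
have dmP k : [/\ 0 <= dm k, ((dm k)%:E <= diam_pow r (F k))%E &
    forall z w, F k z -> F k w -> edist z w <= dm k].
  rewrite /dm; case: eqP => [->|/eqP/set0P F0].
    by split=> //; exact: diam_pow_ge0.
  have dfin : diam (F k) \is a fin_num.
    rewrite ge0_fin_numE ?diam_ge0//; apply: le_lt_trans (Fd k) _; exact: ltry.
  have [D DE] : exists D, diam (F k) = D%:E by exists (fine (diam (F k))); rewrite fineK.
  have := diam_ge0 F0; have := Fd k; rewrite diam_pow_nonempty// DE poweR_EFin !lee_fin /= => D1 D0.
  split=> //; first by rewrite powR_le1_ge ?D0 ?D1// ltW.
  by move=> z w Fz Fw; rewrite -lee_fin -DE edist_le_diam.
pose pt k : R := (xget 0 (F k)) 0 i.
pose I k : set R := [set` `[pt k - dm k, pt k + dm k]].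
pose a := Num.min (x 0 i) (y 0 i); pose b := Num.max (x 0 i) (y 0 i).
have ab : b - a = h.
  rewrite /a /b /h; case: (ltgtP (x 0 i) (y 0 i)) xyi => // lt _.
    by rewrite ger0_norm// subr_ge0 ltW.
  by rewrite ltr0_norm ?subr_lt0// opprB.
have cov : [set` `[a, b]] `<=` \bigcup_k I k.
  move=> u; rewrite /= in_itv /= => /andP[au ub].
  have [z Sz zu] : exists2 z, S z & z 0 i = u.
    pose t := (u - x 0 i) / (y 0 i - x 0 i).
    have yx0 : y 0 i - x 0 i != 0 by rewrite subr_eq0 eq_sym.
    exists ((1 - t) *: x + t *: y); last by rewrite !mxE /t; field.
    rewrite SE; exists t => //; rewrite /= in_itv /=.
    move: au ub; rewrite /a /b /t; case: (ltgtP (x 0 i) (y 0 i)) xyi => // lt _ au ub.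
      apply/andP; split; first by rewrite divr_ge0// subr_ge0// ltW.
      by rewrite ler_pdivrMr ?subr_gt0// mul1r lerB.
    rewrite -mulrNN -invrN !opprB; apply/andP; split.
      by rewrite divr_ge0// subr_ge0// ltW.
    by rewrite ler_pdivrMr ?subr_gt0// mul1r lerB.
  have [k _ Fz] := SF z Sz; exists k => //; rewrite /I /= in_itv /=.
  have [_ _ dk] := dmP k.
  have Fpt : F k (xget 0 (F k)) by apply: (@xgetPex _ _ (F k)); exists z.
  have := le_trans (coord_le_edist i _ _) (dk _ _ Fz Fpt).
  by rewrite zu -/(pt k) ler_distl.
have : (lebesgue_measure [set` `[a, b]] <= \sum_(0 <= k <oo) lebesgue_measure (I k))%E.
  apply: measure_sigma_subadditive => // k; exact: measurable_itv.
rewrite lebesgue_measure_itv /= lte_fin.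
have -> : a < b by rewrite -subr_gt0 ab.
rewrite -EFinD ab => le.
have : (h%:E <= 2%:E * \sum_(0 <= k <oo) diam_pow r (F k))%E.
  apply: le_trans le _; rewrite -nneseriesZl; last by move=> *; exact: diam_pow_ge0.
  apply: lee_nneseries => [k _ _|k _]; first exact: measure_ge0.
  have [dk0 dkr _] := dmP k.
  apply: (@le_trans _ _ (2 * dm k)%:E); last by rewrite EFinM lee_wpmul2l// lee_fin.
  rewrite /I lebesgue_measure_itv /=; case: ifP => _; last by rewrite lee_fin mulr_ge0.
  by rewrite -EFinD lee_fin; lra.
apply/negP; rewrite -ltNge.
apply: (@lt_trans _ _ (2%:E * (h / 4)%:E)%E); first by rewrite lte_pmul2l// lte_fin.
by rewrite -EFinM lte_fin; lra.
Qed.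

Lemma segment_sub_line {n : nat} (x y : 'rV[R]_n) :
  [set (1 - t) *: x + t *: y | t in `[0, 1]] `<=` affine_line x (y - x).
Proof.
move=> _ [t _ <-]; exists t => //.
by rewrite scalerBr scalerBl scale1r -addrA [- _ + _]addrC.
Qed.

Lemma segment_line {n : nat} (S : set 'rV[R]_n) : line_segments S ->
  exists2 l, affine_lines l & S `<=` l.
Proof.
move=> [x [y [xy ->]]]; exists (affine_line x (y - x)); last exact: segment_sub_line.
by exists x, (y - x); rewrite subr_eq0 eq_sym.
Qed.

End Extension.

Theorem proposition1p4 (R : realType) :
  (forall (s : R) (E : set 'rV[R]_2),
     0 < s <= 1 -> union_of_line_subsets s E ->
     (hausdorff_dim (hausdorff_extension s E)
        <= hausdorff_dim E + (2 - 2 * s)%:E)%E)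
  /\
  (forall E : set 'rV[R]_2,
     union_of_segments E ->
     hausdorff_dim (lineal_extension E) = hausdorff_dim E).
Proof.
split=> [s E s01 _|E [C CS EC]]; first exact: hausdorff_dim_extension_le.
apply/eqP; rewrite eq_le; apply/andP; split; last first.
  apply: hausdorff_dim_mono => z; rewrite {1}EC => -[S CSS Sz].
  have [l ll Sl] := segment_line (CS _ CSS).
  exists l; last exact: Sl.
  split=> //; exists S; first exact: CS.
  by move=> w Sw; split; [rewrite EC; exists S|exact: Sl].
(* A segment has dimension at least 1, so the lineal extension lies in the extension for [s = 1],
   where the loss 2 - 2s vanishes. *)
apply: (@le_trans _ _ (hausdorff_dim (hausdorff_extension 1 E))).
  apply: hausdorff_dim_mono => z [l [ll [S SS SEl]] lz]; exists l => //; split=> //.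
  apply: le_trans (hausdorff_dim_segment_ge1 SS) _; apply: hausdorff_dim_mono.
  by rewrite setIC.
have : (hausdorff_dim (hausdorff_extension 1 E)
    <= hausdorff_dim E + (2 - 2 * 1)%:E)%E.
  by apply: hausdorff_dim_extension_le; rewrite ltr01 lexx.
by rewrite mulr1 subrr adde0.
Qed.
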